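(* For integers $m,n\ge 1$, let $\mathrm{Rook}_{m,n}$ be the $m\times n$ rook graph and let $\mathcal{R}$ denote the representation number. Then $\mathcal{R}(\mathrm{Rook}_{m,n})$ is finite for all $m,n\ge 1$, and: \begin{itemize} \item $\mathcal{R}(\mathrm{Rook}_{1,n})=1$ for all $n\ge 1$; \item $\mathcal{R}(\mathrm{Rook}_{2,1})=1$, $\mathcal{R}(\mathrm{Rook}_{2,2})=2$, and $\mathcal{R}(\mathrm{Rook}_{2,n})=3$ for all $n\ge 3$; \item $\mathcal{R}(\mathrm{Rook}_{3,1})=1$, $\mathcal{R}(\mathrm{Rook}_{3,2})=3$, and $\mathcal{R}(\mathrm{Rook}_{3,3})=3$. \end{itemize}
   Context: All graphs are finite, simple and undirected. Two distinct letters $x,y$ alternate in a word $w$ if deleting from $w$ all letters other than $x$ and $y$ leaves a word of the form $xyxy\cdots$ or $yxyx\cdots$ (of even or odd length). A word $w$ over the alphabet $V$, in which every letter of $V$ occurs, represents a graph $G=(V,E)$ if for all distinct $x,y\in V$: $x$ and $y$ alternate in $w$ if and only if $(x,y)\in E$. $G$ is word-representable if some word represents it. $G$ is $k$-representable if it is represented by a word in which each letter appears exactly $k$ times. The representation number $\mathcal{R}(G)$ is the smallest integer $k\ge 1$ such that $G$ is $k$-representable; $\mathcal{R}(G)=\infty$ if $G$ is not word-representable. (Every word-representable graph is $k$-representable for some $k$.) The rook graph $\mathrm{Rook}_{m,n}$ has vertex set $\{x_{i,j}: 1\le i\le m,\ 1\le j\le n\}$, and two distinct vertices $x_{a,b}$,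 $x_{c,d}$ are adjacent if and only if $a=c$ or $b=d$. *)

(* Defs.v *)
From mathcomp Require Import all_boot.
From mathcomp Require Import zify.
From mathcomp Require Import boolp.

Set Implicit Arguments.
Unset Strict Implicit.
Unset Printing Implicit Defensive.

Record sgraph := SGraph {
  vertex :> finType;
  adj : rel vertex;
  adj_sym : symmetric adj;
  adj_irr : irreflexive adj
}.

(* The word x y x y ... of length n. *)
Definition altword (T : Type) (x y : T) (n : nat) : seq T :=
  mkseq (fun i => if odd i then y else x) n.

Definition alternate (T : eqType) (w : seq T) (x y : T) : bool :=
  let s := [seq z <- w | (z == x) || (z == y)] in
  (s == altword x y (size s)) || (s == altword y x (size s)).

Definition represents (G : sgraph) (w : seq G) : Prop :=
  (forall x : G, x \in w) /\
  (forall x y : G, x != y -> (alternate w x y <-> adj x y)).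

Definition word_representable (G : sgraph) : Prop :=
  exists w : seq G, represents w.

Definition k_representable (G : sgraph) (k : nat) : Prop :=
  exists2 w : seq G, represents w & forall x : G, count_mem x w = k.

(* None stands for infinity.  It is returned when no k >= 1 works, which is the
   same as G not being word-representable: see repr_number_None. *)
Definition repr_number (G : sgraph) : option nat :=
  match pselect (exists k, (0 < k) && `[< k_representable G k >]) with
  | left k_exists => Some (ex_minn k_exists)
  | right _ => None
  end.

Lemma repr_numberP (G : sgraph) (k : nat) :
  repr_number G = Some k <->
  [/\ 0 < k, k_representable G k
    & forall j, 0 < j -> k_representable G j -> k <= j].
Proof.
rewrite /repr_number; case: pselect => [h|h]; last first.
  by split=> // -[k0 kr _]; case: h; exists k; rewrite k0; apply/asboolP.
case: ex_minnP => m /andP[m0 /asboolP mr] mmin; split=> [[<-]|[k0 kr kmin]].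
  by split=> // j j0 jr; apply: mmin; rewrite j0; apply/asboolP.
congr Some; apply/eqP; rewrite eqn_leq kmin // andbT.
by apply: mmin; rewrite k0; apply/asboolP.
Qed.

Section Alternation.
Variable T : eqType.
Implicit Types (x y : T) (s w : seq T).
Let ne : rel T := fun a b => a != b.

Lemma altwordS x y n : altword x y n.+1 = x :: altword y x n.
Proof.
rewrite /altword /mkseq /= -add1n iotaDl -map_comp; congr cons.
by apply: eq_map => i /=; case: odd.
Qed.

Lemma path_altword x y s : x != y -> all (fun z => (z == x) || (z == y)) s ->
  (path ne x s = (s == altword y x (size s))).
Proof.
elim: s x y => [|a s IH] x y xy //= /andP[ha hs].
rewrite altwordS eqseq_cons.
case/orP: ha => /eqP->; rewrite /ne ?eqxx ?(negbTE xy) //=.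
apply: IH; first by rewrite eq_sym.
by apply: sub_all hs => z; rewrite orbC.
Qed.

Lemma alternateE w x y : x != y ->
  alternate w x y = sorted ne [seq z <- w | (z == x) || (z == y)].
Proof.
move=> xy; rewrite /alternate.
have := filter_all (fun z => (z == x) || (z == y)) w.
case: [seq z <- w | _] => [|a s] //= /andP[ha hs].
rewrite !altwordS !eqseq_cons.
have yx : y != x by rewrite eq_sym.
have hs' : all (fun z => (z == y) || (z == x)) s.
  by apply: sub_all hs => z; rewrite orbC.
case/orP: ha => /eqP->; rewrite !eqxx ?(negbTE xy) ?(negbTE yx) /= ?orbF.
  by rewrite (path_altword xy).
by rewrite (path_altword yx).
Qed.

Lemma alternateC w x y : alternate w x y = alternate w y x.
Proof.
rewrite /alternate orbC.
by have -> : [seq z <- w | (z == x) || (z == y)] = [seq z <- w | (z == y) || (z == x)]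
  by apply: eq_filter => z; rewrite orbC.
Qed.

Lemma path_count x y s : x != y -> all (fun z => (z == x) || (z == y)) s ->
  path ne x s -> count_mem x s <= count_mem y s <= (count_mem x s).+1.
Proof.
elim: s x y => [|a s IH] x y xy //= /andP[ha hs] /andP[xa ps].
case/orP: ha => /eqP E; subst a; first by rewrite /ne eqxx in xa.
have yx : y != x by rewrite eq_sym.
have hs' : all (fun z => (z == y) || (z == x)) s.
  by apply: sub_all hs => z; rewrite orbC.
have := IH _ _ yx hs' ps.
rewrite eqxx (negbTE yx). lia.
Qed.

Lemma head_index w x y s : x != y ->
  [seq z <- w | (z == x) || (z == y)] = x :: s -> index x w < index y w.
Proof.
move=> xy; elim: w => [|a w IH] //=.
case: (eqVneq a x) => [->|ax] /=; first by rewrite (negbTE xy).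
by case: (eqVneq a y) => [->|ay] /= => [[E]|/IH//]; rewrite E eqxx in xy.
Qed.
End Alternation.

Section Uniformization.
Variable G : sgraph.
Implicit Types (x y : G) (w : seq G).

(* A new copy of x may be put in front when x has the fewest occurrences and,
   among such letters, the latest first occurrence; repeating this makes the
   word uniform. *)
Lemma represents_cons w x : represents w ->
  (forall y, count_mem x w <= count_mem y w) ->
  (forall y, count_mem y w = count_mem x w -> index y w <= index x w) ->
  represents (x :: w).
Proof.
move=> [win wr] cmin imax; split=> [z|]; first by rewrite inE win orbT.
have key y : x != y -> alternate (x :: w) x y = alternate w x y.
  move=> xy; rewrite !alternateE //= eqxx /=.
  case E: [seq _ <- _ | _] => [|a s] //=.
  have := filter_all (fun z => (z == x) || (z == y)) w.
  rewrite E /= => /andP[/orP[] /eqP ?]; subst a; last by rewrite xy.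
  move=> hs; rewrite eqxx /=; symmetry; apply/negbTE/negP=> ps.
  have /andP[_ c2] := path_count xy hs ps.
  have cx z : (z == x) || (z == y) -> count_mem z (x :: s) = count_mem z w.
    move=> hz; rewrite -E count_filter; apply: eq_count => t /=.
    by case: (eqVneq t z) => [->|].
  have H1 := cx x; have H2 := cx y.
  move: H1 H2; rewrite /= !eqxx orbT (negbTE xy) => /(_ isT) H1 /(_ isT) H2.
  have := head_index xy E; rewrite ltnNge imax //; have := cmin y; rewrite -H1 -H2 !add0n add1n => c1; apply/eqP; rewrite eqn_leq c1 c2 //.
move=> a b ab; rewrite -wr //.
case: (eqVneq x a) => [xa|xa]; first by subst a; rewrite key.
case: (eqVneq x b) => [xb|xb].
  by subst b; rewrite alternateC key 1?eq_sym // alternateC.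
by rewrite /alternate /= (negbTE xa) (negbTE xb).
Qed.


Lemma word_k_representable : word_representable G ->
  exists2 k, 0 < k & k_representable G k.
Proof.
case=> w0 w0r.
case: (pickP (fun _ : G => true)) => [x0 _|G0]; last first.
  by exists 1 => //; exists w0 => // x; have := G0 x.
pose M := \sum_x count_mem x w0.
suff: forall n w, represents w -> (forall x, count_mem x w <= M) ->
   \sum_x (M - count_mem x w) <= n -> exists2 k, 0 < k & k_representable G k.
  move/(_ _ w0 w0r); apply; [move=> x|exact: leqnn].
  by rewrite /M (bigD1 x) //= leq_addr.
elim=> [|n IH] w wr wM hn.
  exists M; last first.
    exists w => // x; apply/eqP; rewrite eqn_leq wM /= -subn_eq0 -leqn0.
    by apply: leq_trans hn; rewrite (bigD1 x) //= leq_addr.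
  apply: leq_trans (wM x0); have := wr.1 x0.
  by rewrite -has_pred1 has_count.
have [z _ zmin] := arg_minnP (P := xpredT) (fun x : G => count_mem x w) (isT : xpredT x0).
pose P y := count_mem y w == count_mem z w.
have [x Px xmax] := arg_maxnP (P := P) (fun x : G => index x w) (eqxx _ : P z).
move/eqP: Px => Px.
have [xlt|xge] := ltnP (count_mem x w) M; last first.
  exists M; last first.
    exists w => // y; apply/eqP; rewrite eqn_leq wM /=.
    by apply: leq_trans xge _; rewrite Px zmin.
  apply: leq_trans (wM x0); have := wr.1 x0.
  by rewrite -has_pred1 has_count.
apply: (IH (x :: w)).
- apply: represents_cons => // y; first by rewrite Px zmin.
  by move=> E; apply: xmax; rewrite /P E Px.
- by move=> y /=; case: (eqVneq x y) => [<-|_] //=; rewrite add0n.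
- rewrite -ltnS; apply: leq_trans hn.
  rewrite (bigD1 x) //= [X in _ < X](bigD1 x) //= eqxx.
  have -> : \sum_(i | i != x) (M - ((x == i) + count_mem i w)) =
            \sum_(i | i != x) (M - count_mem i w).
    by apply: eq_bigr => i; rewrite eq_sym => /negbTE->.
  by rewrite ltn_add2r add1n subnS prednK ?subn_gt0 // .
Qed.

Lemma repr_number_None : repr_number G = None <-> ~ word_representable G.
Proof.
rewrite /repr_number; case: pselect => [h|h]; split=> //.
  by case: h => k /andP[_ /asboolP[w wr _]] []; exists w.
move=> _ /word_k_representable[k k0 kr].
by apply: h; exists k; rewrite k0; apply/asboolP.
Qed.
End Uniformization.

Definition rook_adj (m n : nat) : rel ('I_m * 'I_n) :=
  fun u v => (u != v) && ((u.1 == v.1) || (u.2 == v.2)).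

Lemma rook_adj_sym (m n : nat) : symmetric (@rook_adj m n).
Proof.
by move=> u v; rewrite /rook_adj eq_sym (eq_sym u.1) (eq_sym u.2).
Qed.

Lemma rook_adj_irr (m n : nat) : irreflexive (@rook_adj m n).
Proof. by move=> u; rewrite /rook_adj eqxx. Qed.

Definition Rook (m n : nat) : sgraph :=
  SGraph (@rook_adj_sym m n) (@rook_adj_irr m n).

(* Main.v *)
Require Import Defs.
From mathcomp Require Import all_boot.

(** For all m and n, a pivot p = (i, j) cuts the board into the quadrants A (row
    <= i, column <= j), B (row > i, column <= j), C (row <= i, column > j) and D
    (row > i, column > j), each listed in order of increasing row + column.  In
    the word A B C A D C B D two adjacent vertices u < v always leave u v u v,
    whereas A against D leaves a a d d and B against C leaves b c c b.  Any two
    non-adjacent vertices are opposed in this way for some pivot, so the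
    concatenation over all pivots represents the rook graph.

    For two rows a and b, the 3-uniform word
    (a_1 b_1 ... a_n b_n)(a_1 ... a_n)(b_1 a_1 ... b_n a_n)(b_1 ... b_n) works,
    and the 3 x 3 board has a 27-letter word found by computer search.

    For the lower bounds, a word with one copy of each letter makes all pairs
    alternate.  That no 2-uniform word represents the 2 x 3 board is decided by
    inserting the six vertices one after the other into all partial words
    compatible with the adjacencies so far: no word survives. *)

Set Implicit Arguments.
Unset Strict Implicit.
Unset Printing Implicit Defensive.

(** * Alternation under renaming and restriction, and exhaustive insertion of letters *)

Section Words.
Variable T : eqType.
Implicit Types (x y : T) (s w : seq T).

Lemma altword_map (T' : eqType) (f : T -> T') x y n :
  map f (altword x y n) = altword (f x) (f y) n.
Proof. by rewrite /altword /mkseq -map_comp; apply: eq_map => i /=; case: odd. Qed.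

Lemma alternate_map (T' : eqType) (f : T -> T') w x y :
  injective f -> alternate (map f w) (f x) (f y) = alternate w x y.
Proof.
move=> injf; rewrite /alternate filter_map size_map.
rewrite (@eq_filter _ (preim f _) (fun z => (z == x) || (z == y))); last first.
  by move=> z /=; rewrite !inj_eq.
by rewrite -!altword_map !(inj_eq (inj_map injf)).
Qed.

Lemma alternate_filter (a : pred T) w x y :
  a x -> a y -> alternate (filter a w) x y = alternate w x y.
Proof.
move=> ax ay; rewrite /alternate -filter_predI.
rewrite (@eq_filter _ (predI _ a) (fun z => (z == x) || (z == y))) //.
by move=> z /=; case: (eqVneq z x) => [->|_] /=; [|case: eqVneq => [->|]].
Qed.

Lemma uniq_alternate w x y : uniq w -> x != y -> alternate w x y.
Proof.
move=> /(filter_uniq (fun z => (z == x) || (z == y))) uw xy.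
rewrite alternateE //; case: filter uw => //= a s.
elim: s a => //= b s IH a /and3P[]; rewrite inE negb_or => /andP[-> _] bs us /=.
by apply: IH; rewrite /= bs.
Qed.

Lemma filter_flatten_map (I : eqType) (F : I -> seq T) (P : pred T) (Q : pred I) r :
  (forall k, ~~ Q k -> ~~ has P (F k)) ->
  filter P (flatten (map F r)) = filter P (flatten (map F (filter Q r))).
Proof.
move=> PQ; elim: r => //= k r IH; rewrite filter_cat IH.
case: ifP => /= [_|/negbT /PQ]; first by rewrite filter_cat.
by rewrite has_filter negbK => /eqP ->.
Qed.

Lemma sorted_flatten (e : rel T) (ss : seq (seq T)) s :
  s \in ss -> sorted e (flatten ss) -> sorted e s.
Proof.
elim: ss => //= t ss IH; rewrite inE => /orP[/eqP ->|/IH {}IH] /cat_sorted2[] //.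
Qed.

Lemma filter_pair s x y : uniq s -> x \in s -> y \in s -> x != y ->
  let t := [seq z <- s | (z == x) || (z == y)] in t = [:: x; y] \/ t = [:: y; x].
Proof.
move=> us xs ys xy /=; set t := filter _ _.
have : perm_eq t [:: x; y].
  apply: uniq_perm => [||z]; first exact: filter_uniq.
    by rewrite /= inE xy.
  rewrite mem_filter !inE; case: (eqVneq z x) => [->|_] //=.
  by case: eqVneq => [->|].
move=> pt; have := perm_size pt; have := perm_mem pt; have := perm_uniq pt.
case: t {pt} => [|a [|b [|]]] //= ; rewrite !inE andbT => + /[swap] _.
rewrite xy => ab mt; have := mt x; have := mt y; rewrite !inE !eqxx orbT /=.
by case/orP=> /eqP ?; case/orP=> /eqP ?; subst; move: xy ab; rewrite ?eqxx //; auto.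
Qed.

(* All the words obtained from s by inserting c copies of x, a letter not in s. *)
Fixpoint inserts (x : T) c s : seq (seq T) :=
  if s is y :: s' then
    [seq nseq i x ++ y :: t | i <- iota 0 c.+1, t <- inserts x (c - i) s']
  else [:: nseq c x].

Lemma inserts_cons x c s t : t \in inserts x c s -> x :: t \in inserts x c.+1 s.
Proof.
case: s => [|y s]; first by rewrite /= !inE => /eqP ->.
case/(allpairsPdep (f := fun i t => nseq i x ++ y :: t)) => i [u [ic ui ->]].
apply/(allpairsPdep (f := fun i t => nseq i x ++ y :: t)).
exists i.+1, u; split=> //.
by move: ic; rewrite !mem_iota.
Qed.

Lemma mem_inserts x w : w \in inserts x (count_mem x w) (filter (predC1 x) w).
Proof.
elim: w => [|y w IH] /=; first by rewrite inE.
case: eqVneq => [->|yx] /=; first exact: inserts_cons.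
by rewrite mem_cat subn0 map_f.
Qed.

(** Only pairs containing the new letter [x] are tested: inserting copies of [x] does not change how
    the earlier letters alternate with each other. *)
Fixpoint candidates (r : rel T) c (xs : seq T) : seq (seq T) :=
  if xs is x :: xs' then
    [seq s <- flatten [seq inserts x c s | s <- candidates r c xs']
       | all (fun y => alternate s x y == r x y) xs']
  else [:: [::]].

(** Completeness of the search: the restriction of a [c]-uniform word for [r] survives every stage,
    so an empty list of candidates rules out all such words. *)
Lemma mem_candidates (r : rel T) c xs w :
  uniq xs -> {in xs, forall x, count_mem x w = c} ->
  {in xs &, forall x y, x != y -> alternate w x y = r x y} ->
  [seq z <- w | z \in xs] \in candidates r c xs.
Proof.
elim: xs => [|x xs IH] /=; first by rewrite (eq_filter (a2 := pred0)) ?filter_pred0.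
case/andP=> xxs uxs wc wr; rewrite mem_filter; apply/andP; split.
  apply/allP => y yxs; apply/eqP; rewrite alternate_filter ?inE ?eqxx ?yxs ?orbT //.
  apply: wr; rewrite ?inE ?eqxx ?yxs ?orbT //.
  by apply: contraNneq xxs => ->.
apply/flatten_mapP; exists [seq z <- w | z \in xs].
  by apply: IH => // [y ys|y z ys zs]; [apply: wc|apply: wr]; rewrite inE ?ys ?zs orbT.
(* Deleting [x] from the restriction to [x :: xs] gives the restriction to [xs], from which exactly
   [c] insertions of [x] lead back. *)
have := mem_inserts x [seq z <- w | z \in x :: xs].
rewrite -filter_predI count_filter.
rewrite (@eq_count _ _ (pred1 x)) ?wc ?inE ?eqxx //; last first.
  by move=> z /=; case: eqVneq => [->|]; rewrite ?mem_head.
rewrite (@eq_filter _ (predI _ _) (mem xs)) // => z /=; rewrite inE.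
by case: eqVneq => [->|] //=; apply/esym/negbTE.
Qed.

End Words.

(** * Induced subgraphs and complete graphs *)

Section Representability.

(** Deleting the letters outside the image of [f] and renaming along [f] changes neither the
    alternation nor the multiplicity of the remaining letters. *)
Lemma k_representable_induced (G H : sgraph) (f : H -> G) k :
  injective f -> (forall x y, adj (f x) (f y) = adj x y) ->
  k_representable G k -> k_representable H k.
Proof.
move=> injf adjf [w [win wr] wk].
have [u uE] : exists u, map f u = [seq z <- w | z \in codom f].
  elim: (w) => [|z s [u uE]] /=; first by exists [::].
  by case: ifP => [/codomP[x ->]|_]; [exists (x :: u); rewrite /= uE|exists u].
exists u; first split.
- by move=> x; rewrite -(mem_map injf) uE mem_filter codom_f win.
- move=> x y xy; rewrite -(alternate_map _ _ _ injf) uE.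
  by rewrite alternate_filter ?codom_f // -adjf; apply: wr; rewrite inj_eq.
- move=> x; rewrite -(wk (f x)) -[RHS](_ : count_mem (f x) (map f u) = _).
    by rewrite count_map; apply: eq_count => z /=; rewrite inj_eq.
  rewrite uE count_filter; apply: eq_count => z /=.
  by case: eqVneq => [->|]; rewrite ?codom_f.
Qed.

Lemma one_representable_complete (G : sgraph) (x y : G) :
  k_representable G 1 -> x != y -> adj x y.
Proof.
move=> [w [win wr] wk] xy; apply/(wr x y xy)/uniq_alternate => //.
by apply: count_mem_uniq => z; rewrite wk win.
Qed.

Lemma repr_number_complete (G : sgraph) :
  (forall x y : G, x != y -> adj x y) -> repr_number G = Some 1.
Proof.
move=> Gc; apply/repr_numberP; split=> //; exists (enum G); first split.
- by move=> x; rewrite mem_enum.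
- by move=> x y xy; split=> _; [apply: Gc|apply: uniq_alternate; rewrite ?enum_uniq].
- by move=> x; rewrite count_uniq_mem ?enum_uniq // mem_enum.
Qed.

End Representability.

(** * Rook graphs in numerical coordinates, and lower bounds *)

Section RookCoordinates.

(** Pairs of plain numbers, unlike ordinals, make the conditions on a concrete word decidable by
    [vm_compute]. *)
Definition coords m n (u : 'I_m * 'I_n) : nat * nat := (val u.1, val u.2).

Lemma coords_inj m n : injective (@coords m n).
Proof. by move=> [i j] [i' j'] [/val_inj -> /val_inj ->]. Qed.

(** True on the diagonal, so it agrees with rook adjacency for distinct vertices only. *)
Definition coords_adj (p q : nat * nat) := (p.1 == q.1) || (p.2 == q.2).

Lemma rook_adjE m n (u v : Rook m n) : u != v ->
  adj u v = coords_adj (coords u) (coords v).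
Proof. by move=> /= uv; rewrite /= /rook_adj uv. Qed.

Definition board m n := [seq (i, j) | i <- iota 0 m, j <- iota 0 n].

Lemma boardP m n p : reflect (exists u : 'I_m * 'I_n, p = coords u) (p \in board m n).
Proof.
apply: (iffP allpairsP) => [[[i j] []]|[u ->]].
  by rewrite !mem_iota => /= im jn ->; exists (Ordinal im, Ordinal jn).
by exists (coords u); rewrite !mem_iota /= !ltn_ord.
Qed.

Lemma coords_board m n (u : 'I_m * 'I_n) : coords u \in board m n.
Proof. by apply/boardP; exists u. Qed.

Lemma rook_k_representable_coords m n k (s : seq (nat * nat)) : 0 < k ->
  all (fun p => (p.1 <= m) && (p.2 <= n)) s ->
  all (fun p => count_mem p s == k) (board m.+1 n.+1) ->
  all (fun p => all (fun q => (p == q) || (alternate s p q == coords_adj p q))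
    (board m.+1 n.+1)) (board m.+1 n.+1) ->
  k_representable (Rook m.+1 n.+1) k.
Proof.
move=> k0 /allP sb /allP sk /allP sr.
(* The bounds on [s] ensure that [inord] never falls back on its default value. *)
pose w : seq ('I_m.+1 * 'I_n.+1) := [seq (inord p.1, inord p.2) | p <- s].
have ws : map (@coords _ _) w = s.
  rewrite -map_comp -[RHS]map_id; apply/eq_in_map => -[i j] /sb /andP[/= im jn].
  by rewrite /coords /= !inordK.
have wk x : count_mem x w = k.
  rewrite -(eqP (sk _ (coords_board x))) -ws [RHS]count_map.
  by apply: eq_count => z /=; rewrite (inj_eq (@coords_inj _ _)).
exists w => //; split=> [x|x y xy]; first by rewrite -has_pred1 has_count wk.
rewrite rook_adjE // -(alternate_map _ _ _ (@coords_inj _ _)) ws.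
have /allP /(_ _ (coords_board y)) := sr _ (coords_board x).
by rewrite (inj_eq (@coords_inj _ _)) (negbTE xy) /= => /eqP ->.
Qed.

Lemma rook_widen m n m' n' k : m <= m' -> n <= n' ->
  k_representable (Rook m' n') k -> k_representable (Rook m n) k.
Proof.
move=> mm nn.
have injf : injective (fun u : Rook m n =>
    (widen_ord mm u.1, widen_ord nn u.2) : Rook m' n').
  by move=> [i j] [i' j'] [/val_inj -> /val_inj ->].
apply: (k_representable_induced injf) => u v.
by rewrite /= /rook_adj (inj_eq injf).
Qed.

Lemma rook_transpose m n k :
  k_representable (Rook m n) k -> k_representable (Rook n m) k.
Proof.
have injf : injective (fun u : Rook n m => (u.2, u.1) : Rook m n).
  by move=> [i j] [i' j'] [-> ->].
apply: (k_representable_induced injf) => u v.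
by rewrite /= /rook_adj (inj_eq injf) /= orbC.
Qed.

Lemma rook22_not_1 : ~ k_representable (Rook 2 2) 1.
Proof.
(* Opposite corners are distinct and not adjacent. *)
by move/(@one_representable_complete (Rook 2 2) (ord0, ord0) (ord_max, ord_max))/(_ isT).
Qed.

Lemma rook_candidates m n k :
  k_representable (Rook m n) k -> candidates coords_adj k (board m n) != [::].
Proof.
move=> [w [win wr] wk]; pose s := map (@coords _ _) w.
suff : [seq z <- s | z \in board m n] \in candidates coords_adj k (board m n).
  by case: candidates.
apply: mem_candidates => [|p /boardP[u ->]|p q /boardP[u ->] /boardP[v ->]].
- by apply: allpairs_uniq; rewrite ?iota_uniq // => -[i j] [i' j'] _ _ [-> ->].
- rewrite -[RHS](wk u) count_map; apply: eq_count => z /=.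
  by rewrite (inj_eq (@coords_inj _ _)).
rewrite (inj_eq (@coords_inj _ _)) => uv.
rewrite alternate_map; last exact: coords_inj.
by rewrite -rook_adjE //; apply/idP/idP => /(wr u v uv).
Qed.

Lemma rook23_not_2 : ~ k_representable (Rook 2 3) 2.
Proof.
have noc : candidates coords_adj 2 (board 2 3) = [::] by vm_compute.
by move/rook_candidates; rewrite noc.
Qed.

End RookCoordinates.

(** * Uniform words for the small boards and for two rows *)

Lemma rook22_k_representable : k_representable (Rook 2 2) 2.
Proof.
apply: (@rook_k_representable_coords 1 1 2
  [:: (0,0); (1,0); (0,1); (0,0); (1,1); (0,1); (1,0); (1,1)]);
  by vm_compute.
Qed.

Lemma rook33_k_representable : k_representable (Rook 3 3) 3.
Proof.
apply: (@rook_k_representable_coords 2 2 3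
  [:: (2,2); (1,2); (0,2); (2,1); (2,0); (2,2); (1,1); (1,0); (1,2);
      (0,1); (2,1); (1,1); (0,0); (0,2); (0,1); (2,0); (2,2); (2,1);
      (1,0); (0,0); (2,0); (1,2); (1,1); (1,0); (0,2); (0,1); (0,0)]);
  by vm_compute.
Qed.

Lemma enum_ord_pair n (i j : 'I_n) : i < j ->
  [seq k <- enum 'I_n | (k == i) || (k == j)] = [:: i; j].
Proof.
move=> ij; have ne : i != j by rewrite -val_eqE /= neq_ltn ij.
have [//|E] := filter_pair (enum_uniq 'I_n) (mem_enum _ i) (mem_enum _ j) ne.
have : sorted ltn (map val (enum 'I_n)) by rewrite val_enum_ord iota_ltn_sorted.
rewrite sorted_map.
move/(sorted_filter (fun y x z => @ltn_trans _ _ _) (fun k => (k == i) || (k == j))).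
by rewrite E /= andbT ltnNge (ltnW ij).
Qed.

Lemma rook2n_k_representable n : k_representable (Rook 2 n) 3.
Proof.
pose a (i : 'I_n) : 'I_2 * 'I_n := (ord0, i).
pose b (i : 'I_n) : 'I_2 * 'I_n := (ord_max, i).
pose W r := flatten [seq [:: a i; b i] | i <- r] ++ flatten [seq [:: a i] | i <- r]
  ++ flatten [seq [:: b i; a i] | i <- r] ++ flatten [seq [:: b i] | i <- r].
(* The alternation of two letters involves at most two columns, so the word can be cut down to the
   blocks of these columns and then computed. *)
have filterW (P : pred ('I_2 * 'I_n)) (Q : pred 'I_n) :
    (forall u, P u -> Q u.2) ->
    filter P (W (enum 'I_n)) = filter P (W (filter Q (enum 'I_n))).
  move=> PQ; rewrite /W !filter_cat.
  by congr (_ ++ (_ ++ (_ ++ _))); apply: filter_flatten_map => k Qk /=;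
    rewrite !orbF ?negb_or; do ?[apply/andP; split];
    apply: contraNN Qk => /PQ.
have filterW1 (P : pred ('I_2 * 'I_n)) i : (forall u, P u -> u.2 == i) ->
    filter P (W (enum 'I_n)) = filter P (W [:: i]).
  move=> /(filterW _ (pred1 i)) ->; congr (filter P (W _)).
  by rewrite filter_pred1_uniq ?enum_uniq ?mem_enum.
have filterW2 (P : pred ('I_2 * 'I_n)) (i j : 'I_n) : i < j ->
    (forall u, P u -> (u.2 == i) || (u.2 == j)) ->
    filter P (W (enum 'I_n)) = filter P (W [:: i; j]).
  by move=> ij /(filterW _ (fun k => (k == i) || (k == j))) ->; rewrite enum_ord_pair.
have abP u : (exists i, u = a i) \/ (exists i, u = b i).
  by case: u => -[[|[|//]] h] i; [left|right]; exists i; congr pair; exact: val_inj.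
have aa i j : ((a i == a j) = (i == j)) * ((b i == b j) = (i == j)) by [].
have ab i j : ((a i == b j) = false) * ((b i == a j) = false) by [].
have caa i j : (coords_adj (coords (a i)) (coords (a j)) = true)
  * (coords_adj (coords (b i)) (coords (b j)) = true) by [].
have cab i j : (coords_adj (coords (a i)) (coords (b j)) = (i == j))
  * (coords_adj (coords (b i)) (coords (a j)) = (i == j)) by [].
have snd i : ((a i).2 = i) * ((b i).2 = i) by [].
(* From here on [a] and [b] are known only through these equations, so simplification cannot unfold
   them into pairs. *)
have E := (aa, ab, caa, cab, snd, eqxx).
clearbody a b.
have Wk u : count_mem u (W (enum 'I_n)) = 3.
  rewrite -size_filter (@filterW1 _ u.2) => [|v /eqP -> //].
  by case: (abP u) => -[i ->]; rewrite /= !E.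
exists (W (enum 'I_n)) => //; split=> [u|u v uv].
  by rewrite -has_pred1 has_count Wk.
suff : alternate (W (enum 'I_n)) u v = adj u v by move=> ->.
rewrite rook_adjE //.
wlog uv2 : u v uv / u.2 <= v.2 => [IH|].
  case: (leqP u.2 v.2) => [|/ltnW] uv2; first exact: IH.
  rewrite alternateC IH 1?eq_sym // /coords_adj.
  by rewrite (eq_sym (coords u).1) (eq_sym (coords u).2).
rewrite alternateE //; move: uv2; rewrite leq_eqVlt => /orP[/eqP/val_inj uv2|uv2].
  (* A single column leaves a b a b a b. *)
  rewrite (@filterW1 _ u.2) => [|z /orP[] /eqP -> //]; last by rewrite uv2.
  by case: (abP u) (abP v) uv uv2 => -[i ->] [] [j ->];
    rewrite !E => + ij; rewrite ij ?eqxx // /= !E /= !E.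
(* For columns i < j, two letters of one row leave i j i j i j, whereas across the rows the word
   leaves a_i b_j a_i a_i b_j b_j or b_i a_j a_j b_i a_j b_i, each with a repetition. *)
rewrite (@filterW2 _ u.2 v.2) // => [|z /orP[] /eqP ->]; rewrite ?eqxx ?orbT //.
have ne : u.2 == v.2 = false by rewrite -val_eqE /= (ltn_eqF uv2).
have ne' := ne; rewrite eq_sym in ne'.
case: (abP u) (abP v) ne ne' => -[i ->] [] [j ->]; rewrite !E => ne ne'.
all: by rewrite /W !filter_cat /= ?(aa, ab, ne, ne', eqxx) /=
  ?(aa, ab, caa, cab, ne, ne', eqxx).
Qed.

(** * Word-representability of every rook graph *)

Lemma rook_word_representable m n : word_representable (Rook m n).
Proof.
pose V : finType := ('I_m * 'I_n)%type.
(* lev orders adjacent vertices compatibly with rows and columns; the order of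
   ties, which are never adjacent, is irrelevant. *)
pose lev (u : V) := u.1 + u.2.
pose L := sort (relpre lev leq) (enum V).
have LE (u v : V) : u != v -> let t := [seq z <- L | (z == u) || (z == v)] in
    t = [:: u; v] \/ t = [:: v; u].
  by move=> uv; apply: filter_pair; rewrite ?sort_uniq ?enum_uniq ?mem_sort ?mem_enum.
have Llt (u v : V) : lev u < lev v -> [seq z <- L | (z == u) || (z == v)] = [:: u; v].
  move=> uv; have [|//|E] := LE u v; first by apply: contraTneq uv => ->; rewrite ltnn.
  have : sorted (relpre lev leq) L by apply: sort_sorted => x y; exact: leq_total.
  move/(sorted_filter (fun y x z => @leq_trans _ _ _) (fun z => (z == u) || (z == v))).
  by rewrite E /= leqNgt uv.
pose grp (p u : V) := (p.1 < u.1, p.2 < u.2).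
pose part p g := [seq u <- L | grp p u == g].
(* The quadrant sequence A B C A D C B D; a component is true when the vertex lies strictly beyond
   the pivot in that direction. *)
pose pat := [:: (false, false); (true, false); (false, true); (false, false);
                (true, true); (false, true); (true, false); (true, true)].
pose blk p := flatten [seq part p g | g <- pat].
pose w := flatten [seq blk p | p <- enum V].
pose P (u v : V) := fun z => (z == u) || (z == v).
(* The block of pivot [p] built from an arbitrary list [t] instead of [L]; restricting a block to
   two letters amounts to restricting [L] first. *)
pose blk2 p (t : seq V) := flatten [seq [seq z <- t | grp p z == g] | g <- pat].
have filter_blk u v p : filter (P u v) (blk p) = blk2 p (filter (P u v) L).
  rewrite /blk filter_flatten -map_comp; congr flatten; apply: eq_map => g /=.
  by rewrite /part -!filter_predI; apply: eq_filter => z /=; rewrite andbC.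
have filter_w u v : filter (P u v) w =
    flatten [seq blk2 p (filter (P u v) L) | p <- enum V].
  by rewrite filter_flatten -map_comp; congr flatten; apply: eq_map => p; exact: filter_blk.
have blk_adj p (u v : V) : adj (u : Rook m n) v -> lev u < lev v ->
    blk2 p [:: u; v] = [:: u; v; u; v].
  (* Going from [u] to the higher [v] along a row or column changes at most one quadrant flag, and
     only from false to true. This excludes the pairs A, D and B, C, and each remaining case leaves
     u v u v. *)
  move=> auv luv; have : [&& (grp p u).1 ==> (grp p v).1, (grp p u).2 ==> (grp p v).2
      & ((grp p u).1 == (grp p v).1) || ((grp p u).2 == (grp p v).2)].
    move: luv; case/andP: auv => _ /orP[] /eqP; rewrite /lev /grp /= => ->.
      by rewrite ltn_add2l eqxx implybb andbT => luv; apply/implyP => /ltn_trans; apply.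
    by rewrite ltn_add2r eqxx implybb orbT !andbT => luv; apply/implyP => /ltn_trans; apply.
  case gu: (grp p u) => [a b]; case gv: (grp p v) => [c d] /=.
  rewrite /blk2 /= gu gv => {gu gv}.
  by case: a; case: b; case: c; case: d.
have blk_nadj (u v : V) t : u.1 < v.1 -> u.2 != v.2 ->
    t = [:: u; v] \/ t = [:: v; u] -> exists p, ~~ sorted (fun x y => x != y) (blk2 p t).
  (* If [v] also has the larger column, pivot [u] puts [u] in A and [v] in D, leaving u u v v.
     Otherwise pivot [(u.1, v.2)] puts [u] in C and [v] in B, leaving v u u v. The order in [t] does
     not matter, as the two quadrants differ. *)
  move=> uv1; rewrite -val_eqE neq_ltn => /orP[] uv2 tE; [exists u|exists (u.1, v.2)].
    have guu : grp u u = (false, false) by rewrite /grp !ltnn.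
    have guv : grp u v = (true, true) by rewrite /grp uv1 uv2.
    by case: tE => ->; rewrite /blk2 /= guu guv /= eqxx.
  have guu : grp (u.1, v.2) u = (false, true) by rewrite /grp /= ltnn uv2.
  have guv : grp (u.1, v.2) v = (true, false) by rewrite /grp /= ltnn uv1.
  by case: tE => ->; rewrite /blk2 /= guu guv /= eqxx andbF.
have adj_alt (u v : V) : adj (u : Rook m n) v -> lev u < lev v -> alternate w u v.
  move=> auv luv; have uv : u != v by apply: contraTneq luv => ->; rewrite ltnn.
  rewrite alternateE // [filter _ _]filter_w Llt //.
  rewrite (eq_map (g := fun=> [:: u; v; u; v])); last by move=> p; exact: blk_adj.
  have : path (fun x y => x != y) v (flatten [seq [:: u; v; u; v] | _ <- enum V]).
    elim: (enum V) => //= _ r ->.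
    by rewrite uv eq_sym uv.
  exact: path_sorted.
have nadj_alt (u v : V) : u.1 < v.1 -> u.2 != v.2 -> ~~ alternate w u v.
  move=> uv1 uv2; have uv : u != v by apply: contraTneq uv1 => ->; rewrite ltnn.
  rewrite alternateE // [filter _ _]filter_w.
  have [p] := blk_nadj u v _ uv1 uv2 (LE u v uv).
  (* One block with a repetition spoils the whole word, because blocks are contiguous factors. *)
  apply: contraNN => /(sorted_flatten _); apply.
  by apply: map_f; rewrite mem_enum.
exists w; split=> [u|u v uv].
  apply/flatten_mapP; exists u; first by rewrite mem_enum.
  apply/flatten_mapP; exists (false, false) => //.
  by rewrite mem_filter /grp !ltnn eqxx mem_sort mem_enum.
suff : alternate w u v = adj (u : Rook m n) v by move=> ->.
case: (boolP (adj (u : Rook m n) v)) => [auv|].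
  case: (ltngtP (lev u) (lev v)) => luv; first exact: adj_alt.
    by rewrite alternateC; apply: adj_alt => //; rewrite adj_sym.
  (* Equal levels together with a common row or column would force [u = v]. *)
  case/andP: auv => _ uv'; case/negP: uv; apply/eqP; move: luv uv'.
  case: u v => [i j] [i' j']; rewrite /lev /= => + /orP[] /eqP ij.
    by rewrite ij => /addnI /val_inj ->.
  by rewrite ij => /addIn /val_inj ->.
rewrite /= /rook_adj uv negb_or => /andP[/= uv1 uv2]; apply/negbTE.
move: (uv1); rewrite -val_eqE neq_ltn => /orP[] uv1'; first exact: nadj_alt.
by rewrite alternateC; apply: nadj_alt => //; rewrite eq_sym.
Qed.

(** * The representation numbers *)

Lemma rook2n_repr_number n : 3 <= n -> repr_number (Rook 2 n) = Some 3.
Proof.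
move=> n3; apply/repr_numberP; split=> //; first exact: rook2n_k_representable.
(* The induced 2 x 2 board excludes one copy of each letter, and the induced 2 x 3 board excludes
   two. *)
case=> [|[|[|j]]] // _ h.
  by case: rook22_not_1; apply: rook_widen h => //; apply: ltnW.
by case: rook23_not_2; apply: rook_widen h.
Qed.

Theorem mainTheorem3 :
  (forall m n : nat, 1 <= m -> 1 <= n ->
     exists k : nat, repr_number (Rook m n) = Some k) /\
  (forall n : nat, 1 <= n -> repr_number (Rook 1 n) = Some 1) /\
  (repr_number (Rook 2 1) = Some 1 /\
   repr_number (Rook 2 2) = Some 2 /\
   (forall n : nat, 3 <= n -> repr_number (Rook 2 n) = Some 3)) /\
  (repr_number (Rook 3 1) = Some 1 /\
   repr_number (Rook 3 2) = Some 3 /\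
   repr_number (Rook 3 3) = Some 3).
Proof.
(* A board with a single column is a complete graph. *)
have rook_col m : repr_number (Rook m 1) = Some 1.
  by apply: repr_number_complete => u v uv; rewrite /= /rook_adj uv !ord1 orbT.
split.
  move=> m n _ _; case E: (repr_number _) => [k|]; first by exists k.
  by move/repr_number_None: E; case; exact: rook_word_representable.
split.
  move=> n _; apply: repr_number_complete => u v uv.
  by rewrite /= /rook_adj uv !ord1.
split; split=> //; split.
- apply/repr_numberP; split=> //; first exact: rook22_k_representable.
  by case=> [|[|j]] // _ /rook22_not_1.
- exact: rook2n_repr_number.
- apply/repr_numberP; split=> //.
    by apply: rook_widen rook33_k_representable.
  case=> [|[|[|j]]] // _ h.
    by case: rook22_not_1; apply: rook_widen h.
  by case: rook23_not_2; apply: rook_transpose.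
- apply/repr_numberP; split=> //; first exact: rook33_k_representable.
  case=> [|[|[|j]]] // _ h.
    by case: rook22_not_1; apply: rook_widen h.
  by case: rook23_not_2; apply: rook_widen h.
Qed.
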